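(* Let $\Gamma$ be an alphabet and $E$ an infinite universe of events, and let $\mathbb{P}$, $0$, $1$, $\parallel$, $;$ be as defined in the context. Then $\langle \mathbb{P}, \subseteq\rangle$ is a complete lattice with join $\cup$ (set union) and least element $0$; for each $\Join\in\{\parallel, ;\}$, $\langle \mathbb{P}, \subseteq, \Join, 1\rangle$ is a unital quantale over $\cup$ (i.e. $\langle\mathbb{P},\Join,1\rangle$ is a monoid and $\Join$ distributes over unions in each argument); and for all $\mathcal{U},\mathcal{V},\mathcal{X},\mathcal{Y},\mathcal{Z},\mathcal{P}\in\mathbb{P}$ the following hold: $\mathcal{X}\subseteq\mathcal{Y}$ iff $\mathcal{X}\cup\mathcal{Y}=\mathcal{Y}$; $(\mathcal{U}\parallel\mathcal{V});(\mathcal{X}\parallel\mathcal{Y})\subseteq(\mathcal{U};\mathcal{X})\parallel(\mathcal{V};\mathcal{Y})$; $\mathcal{X}\cup(\mathcal{Y}\cup\mathcal{Z})=(\mathcal{X}\cup\mathcal{Y})\cup\mathcal{Z}$; $\mathcal{X}\cup\mathcal{X}=\mathcal{X}$; $\mathcal{X}\cup 0=0\cup\mathcal{X}=\mathcal{X}$; $\mathcal{X}\cup\mathcal{Y}=\mathcal{Y}\cup\mathcal{X}$; $\mathcal{X}\parallel\mathcal{Y}=\mathcal{Y}\parallel\mathcal{X}$; $\mathcal{X}\parallel 1=1\parallel\mathcal{X}=\mathcal{X}$ and $\mathcal{X};1=1;\mathcal{X}=\mathcal{X}$; $\mathcal{X}\parallel 0=0\parallel\mathcal{X}=0$ and $\mathcal{X};0=0;\mathcal{X}=0$;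 $\mathcal{X}\Join(\mathcal{Y}\cup\mathcal{Z})=(\mathcal{X}\Join\mathcal{Y})\cup(\mathcal{X}\Join\mathcal{Z})$ and $(\mathcal{X}\cup\mathcal{Y})\Join\mathcal{Z}=(\mathcal{X}\Join\mathcal{Z})\cup(\mathcal{Y}\Join\mathcal{Z})$ for $\Join\in\{\parallel,;\}$; $\mathcal{X}\Join(\mathcal{Y}\Join\mathcal{Z})=(\mathcal{X}\Join\mathcal{Y})\Join\mathcal{Z}$ for $\Join\in\{\parallel,;\}$; and for $\Join\in\{\parallel,;\}$ the map $\mathcal{X}\mapsto 1\cup(\mathcal{P}\Join\mathcal{X})$ on $\mathbb{P}$ has a least fixed point $\mathcal{P}^{\Join}=\mu\mathcal{X}.\,1\cup(\mathcal{P}\Join\mathcal{X})$.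
   Context: Fix an alphabet $\Gamma$ and a nonempty (infinite) set $E$ of events; it is a standing convention that $E$ is large enough that the event sets of the compositions below are again subsets of $E$. A partial string is a triple $p=\langle E_p,\alpha_p,\preceq_p\rangle$ with $E_p\subseteq E$, $\alpha_p\colon E_p\to\Gamma$ a function, and $\preceq_p$ a partial order on $E_p$. $\mathsf{P}_f$ denotes the set of finite partial strings ($E_p$ finite); $\bot$ is the empty partial string ($E_\bot=\emptyset$). A monotonic bijective morphism $f\colon x\to y$ is a bijection $f\colon E_x\to E_y$ with $e\preceq_x e'\Rightarrow f(e)\preceq_y f(e')$ and $\alpha_x(e)=\alpha_y(f(e))$ for all $e,e'\in E_x$. Write $x\sqsubseteq y$ iff there is a monotonic bijective morphism $y\to x$. For sets $S,T$ let $S+T=(S\times\{0\})\cup(T\times\{1\})$. For partial strings $x,y$, $x\parallel y$ and $x;y$ both have event set $E_x+E_y$ and labelling $\alpha(\langle e,0\rangle)=\alpha_x(e)$, $\alpha(\langle e,1\rangle)=\alpha_y(e)$; the order of $x\parallel y$ is: $\langle e,i\rangle\preceq\langle e',j\rangle$ iff ($i=j=0$ and $e\preceq_x e'$) or ($i=j=1$ and $e\preceq_y e'$); the order of $x;y$ is: $\langle e,i\rangle\preceq\langle e',j\rangle$ iff $i<j$ or $\langle e,i\rangle\preceq_{x\parallel y}\langle e',j\rangle$. A program is a set $\mathcal{X}\subseteq\mathsf{P}_f$ with $\downarrow\mathcal{X}=\mathcal{X}$, where $\downarrow\mathcal{X}=\{y\in\mathsf{P}_f\mid\exists x\in\mathcal{X}\colon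 y\sqsubseteq x\}$; $\mathbb{P}$ is the family of all programs. $0=\emptyset$, $1=\{\bot\}$. For programs $\mathcal{X},\mathcal{Y}$ and $\Join\in\{\parallel,;\}$, $\mathcal{X}\Join\mathcal{Y}=\downarrow\{x\Join y\mid x\in\mathcal{X},y\in\mathcal{Y}\}$. A unital quantale is a complete lattice $Q$ with a monoid structure $\langle Q,\cdot,1\rangle$ such that $x\cdot\bigvee S=\bigvee\{x\cdot y\mid y\in S\}$ and $(\bigvee S)\cdot x=\bigvee\{y\cdot x\mid y\in S\}$ for all $S\subseteq Q$, $x\in Q$. *)

(* Defs.v *)
From Stdlib Require Import Relation_Definitions.
From mathcomp Require Import all_boot.
From mathcomp Require Import boolp classical_sets functions cardinality.

Set Implicit Arguments.
Unset Strict Implicit.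
Unset Printing Implicit Defensive.

Local Open Scope classical_set_scope.

Declare Scope program_scope.
Delimit Scope program_scope with P.

Section CompleteLatticesAndQuantales.
Variables (Q : Type) (le : relation Q).

Definition is_lub (S : set Q) (u : Q) : Prop :=
  (forall x, S x -> le x u) /\
  (forall v, (forall x, S x -> le x v) -> le u v).

Definition is_glb (S : set Q) (l : Q) : Prop :=
  (forall x, S x -> le l x) /\
  (forall v, (forall x, S x -> le v x) -> le v l).

Definition is_complete_lattice (sup : set Q -> Q) : Prop :=
  [/\ Relation_Definitions.order Q le,
      forall S : set Q, is_lub S (sup S)
    & forall S : set Q, exists m, is_glb S m].

Definition is_monoid (mul : Q -> Q -> Q) (one : Q) : Prop :=
  [/\ associative mul, left_id one mul & right_id one mul].

Definition is_unital_quantale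
    (sup : set Q -> Q) (mul : Q -> Q -> Q) (one : Q) : Prop :=
  [/\ is_complete_lattice sup,
      is_monoid mul one,
      forall (x : Q) (S : set Q), mul x (sup S) = sup [set mul x y | y in S]
    & forall (x : Q) (S : set Q), mul (sup S) x = sup [set mul y x | y in S]].

Definition is_least_fixpoint (f : Q -> Q) (m : Q) : Prop :=
  f m = m /\ forall x, f x = x -> le m x.

End CompleteLatticesAndQuantales.

(* An infinite universe that is closed under the tagging of events with 0
   (false) and 1 (true).  Set-theoretically this closure is an inclusion of
   E * {0, 1} in E; in type theory it is an injection. *)
Record eventUniverse := EventUniverse {
  event :> Type;
  event_infinite : infinite_set [set: event];
  tag_event : event * bool -> event;
  tag_event_inj : injective tag_event }.

(* Labels and order live on the subtype of the events, so that Leibniz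
   equality of partial strings is equality of the underlying triples; in
   particular there is exactly one partial string with no events. *)
Record pstring (Gamma : Type) (E : eventUniverse) := PString {
  events : set E;
  label : events -> Gamma;
  prec : relation events;
  prec_order : Relation_Definitions.order events prec }.

Arguments events {Gamma E} p.
Arguments label {Gamma E p} e.
Arguments prec {Gamma E p} e e'.

Section PartialStrings.
Variables (Gamma : Type) (E : eventUniverse).
Implicit Types x y z : pstring Gamma E.

Definition finite_pstring : set (pstring Gamma E) :=
  [set x | finite_set (events x)].

Definition monotonic_bijective_morphism x y (f : events x -> events y) : Prop :=
  [/\ bijective f,
      forall e e', prec e e' -> prec (f e) (f e')
    & forall e, label e = label (f e)].

Definition refines x y : Prop :=
  exists f : events y -> events x, monotonic_bijective_morphism f.

Lemma refines_refl x : refines x x.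
Proof. by exists id; split => //; exists id. Qed.

Lemma refines_trans x y z : refines x y -> refines y z -> refines x z.
Proof.
move=> [f [bf mf lf]] [g [bg mg lg]]; exists (f \o g); split => /=.
- exact: bij_comp.
- by move=> e e' /mg /mf.
- by move=> e; rewrite lg lf.
Qed.

(* A labelled partial order on T, transported to the range of f : T -> E.
   When f is injective, as in all uses below, range_preim is the inverse
   of f on its range. *)
Section Transport.
Variables (T : Type) (f : T -> E).

Definition range_preim (s : range f) : T := projT1 (cid2 (set_mem (valP s))).

Lemma range_preimK (s : range f) : f (range_preim s) = val s.
Proof. by rewrite /range_preim; case: cid2. Qed.

Lemma transport_order (r : relation T) : Relation_Definitions.order T r ->
  Relation_Definitions.order (range f)
    (fun s s' => r (range_preim s) (range_preim s')).
Proof.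
move=> [rr rt ra]; split.
- by move=> s; exact: rr.
- by move=> s1 s2 s3; exact: rt.
- move=> s s' h h'; apply: val_inj.
  by rewrite -!range_preimK (ra _ _ h h').
Qed.

Definition transport (lab : T -> Gamma) (r : relation T)
    (hr : Relation_Definitions.order T r) : pstring Gamma E :=
  PString (fun s => lab (range_preim s)) (transport_order hr).

End Transport.

Lemma empty_order :
  Relation_Definitions.order void (fun _ _ => True).
Proof. by split=> -[]. Qed.

Definition bot_pstring : pstring Gamma E :=
  transport (of_void E) (of_void Gamma) empty_order.

Lemma events_bot : events bot_pstring = set0.
Proof. by rewrite -subset0 => e [[]]. Qed.

Lemma pstring_eq0 x y : events x = set0 -> events y = set0 -> x = y.
Proof.
case: x y => [A a r hr] [B b s hs] /= A0 B0; subst A B.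
have F (e : (set0 : set E)) : False.
  by have := set_mem (valP e).
have -> : a = b by apply/funext => e; case: (F e).
have rs : r = s by apply/funext => e; case: (F e).
by subst s; rewrite (Prop_irrelevance hr hs).
Qed.

Lemma refines_bot x : refines x bot_pstring -> x = bot_pstring.
Proof.
move=> [f [[g _ _] _ _]]; apply: pstring_eq0; last exact: events_bot.
rewrite -subset0 => e xe.
by case: (set_mem (valP (g (exist _ e (mem_set xe))))) => -[].
Qed.

Section Composition.
Variables x y : pstring Gamma E.

(* events x + events y, with the left summand tagged 0 and the right one
   tagged 1. *)
Definition sum_event (s : events x + events y) : E :=
  match s with
  | inl e => tag_event (val e, false)
  | inr e => tag_event (val e, true)
  end.

Lemma sum_event_inj : injective sum_event.
Proof.
by move=> [e|e] [e'|e'] /= /tag_event_inj [] // /val_inj ->.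
Qed.

Definition sum_index (s : events x + events y) : nat :=
  if s is inl _ then 0 else 1.

Definition sum_label (s : events x + events y) : Gamma :=
  match s with inl e => label e | inr e => label e end.

Definition par_prec : relation (events x + events y) := fun s s' =>
  match s, s' with
  | inl e, inl e' => prec e e'
  | inr e, inr e' => prec e e'
  | _, _ => False
  end.

Definition seq_prec : relation (events x + events y) := fun s s' =>
  sum_index s < sum_index s' \/ par_prec s s'.

Lemma par_prec_order : Relation_Definitions.order _ par_prec.
Proof.
have [rx tx ax] := prec_order x; have [ry ty ay] := prec_order y; split.
- by move=> [e|e]; [exact: rx|exact: ry].
- by move=> [e1|e1] [e2|e2] [e3|e3] //=; [exact: tx|exact: ty].
- move=> [e|e] [e'|e'] //= h h'.
    by rewrite (ax _ _ h h').
  by rewrite (ay _ _ h h').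
Qed.

Lemma seq_prec_order : Relation_Definitions.order _ seq_prec.
Proof.
have [pr pt pa] := par_prec_order; split.
- by move=> s; right; exact: pr.
- move=> s1 s2 s3 [h|h] [h'|h'].
  + by left; apply: ltn_trans h h'.
  + by left; case: s1 s2 s3 h h' => [e1|e1] [e2|e2] [e3|e3].
  + by left; case: s1 s2 s3 h h' => [e1|e1] [e2|e2] [e3|e3].
  + by right; apply: pt h h'.
- move=> s s' [h|h] [h'|h'].
  + by have := ltn_trans h h'; rewrite ltnn.
  + by case: s s' h h' => [e|e] [e'|e'].
  + by case: s s' h h' => [e|e] [e'|e'].
  + exact: pa.
Qed.

Definition par_pstring : pstring Gamma E :=
  transport sum_event sum_label par_prec_order.

Definition seq_pstring : pstring Gamma E :=
  transport sum_event sum_label seq_prec_order.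

End Composition.

Definition down (A : set (pstring Gamma E)) : set (pstring Gamma E) :=
  [set y | finite_pstring y /\ exists x, A x /\ refines y x].

Record program := Program {
  program_set :> set (pstring Gamma E);
  program_finite : program_set `<=` finite_pstring;
  program_down : down program_set = program_set }.

Implicit Types X Y : program.

Lemma down_finite A : down A `<=` finite_pstring.
Proof. by move=> x []. Qed.

Lemma down_idem A : down (down A) = down A.
Proof.
rewrite eqEsubset; split=> [x [fx [y [[fy [z [Az yz]]] xy]]]|x Ax].
  by split=> //; exists z; split=> //; exact: refines_trans xy yz.
by split; [exact: down_finite Ax|exists x; split=> //; exact: refines_refl].
Qed.

Definition program_of_down (A : set (pstring Gamma E)) : program :=
  Program (@down_finite A) (down_idem A).

Lemma program0_finite : @set0 (pstring Gamma E) `<=` finite_pstring.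
Proof. by []. Qed.

Lemma program0_down : down set0 = set0.
Proof. by rewrite -subset0 => x [_ [y []]]. Qed.

Definition program0 : program := Program program0_finite program0_down.

Lemma program1_finite : [set bot_pstring] `<=` finite_pstring.
Proof.
move=> _ ->; suff: finite_set (events bot_pstring) by [].
by rewrite events_bot; exact: finite_set0.
Qed.

Lemma program1_down : down [set bot_pstring] = [set bot_pstring].
Proof.
rewrite eqEsubset; split=> [x [_ [_ [-> /refines_bot]]]//|_ ->].
split; first exact: program1_finite.
by exists bot_pstring; split=> //; exact: refines_refl.
Qed.

Definition program1 : program := Program program1_finite program1_down.

Lemma bigcup_program_finite (S : set program) :
  \bigcup_(X in S) (X : set _) `<=` finite_pstring.
Proof. by move=> x [X _ /program_finite]. Qed.

Lemma bigcup_program_down (S : set program) :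
  down (\bigcup_(X in S) (X : set _)) = \bigcup_(X in S) (X : set _).
Proof.
rewrite eqEsubset; split=> [x [fx [y [[X SX Xy] xy]]]|x Ux].
  by exists X => //; rewrite -program_down; split=> //; exists y.
split; first exact: bigcup_program_finite Ux.
by exists x; split=> //; exact: refines_refl.
Qed.

Definition program_bigcup (S : set program) : program :=
  Program (@bigcup_program_finite S) (bigcup_program_down S).

Lemma cup_program_finite X Y : X `|` Y `<=` finite_pstring.
Proof. by move=> x [] /program_finite. Qed.

Lemma cup_program_down X Y : down (X `|` Y) = X `|` Y.
Proof.
rewrite eqEsubset; split=> [x [fx [y [[Xy|Yy] xy]]]|x Ux].
- by left; rewrite -program_down; split=> //; exists y.
- by right; rewrite -program_down; split=> //; exists y.
split; first exact: cup_program_finite Ux.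
by exists x; split=> //; exact: refines_refl.
Qed.

Definition program_cup X Y : program :=
  Program (@cup_program_finite X Y) (cup_program_down X Y).

Definition program_sub : relation program := fun X Y => X `<=` Y.

End PartialStrings.

Arguments program0 {Gamma E}.
Arguments program1 {Gamma E}.

Inductive connective := Par | Seq.

Definition pstring_comp (c : connective) (Gamma : Type) (E : eventUniverse) :
    pstring Gamma E -> pstring Gamma E -> pstring Gamma E :=
  match c with
  | Par => @par_pstring Gamma E
  | Seq => @seq_pstring Gamma E
  end.

Definition program_comp (c : connective) (Gamma : Type) (E : eventUniverse)
    (X Y : program Gamma E) : program Gamma E :=
  program_of_down [set pstring_comp c x y | x in X & y in Y].

Bind Scope program_scope with program.

Notation "0" := program0 : program_scope.
Notation "1" := program1 : program_scope.
Notation "X ⊆ Y" := (program_sub X Y)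
  (at level 70, no associativity) : program_scope.
Notation "X ∪ Y" := (program_cup X Y)
  (at level 50, left associativity) : program_scope.
Notation "X ⋈[ c ] Y" := (program_comp c X Y)
  (at level 40, left associativity, format "X  ⋈[ c ]  Y") : program_scope.
Notation "X ∥ Y" := (program_comp Par X Y)
  (at level 40, left associativity) : program_scope.
Notation "X ⨟ Y" := (program_comp Seq X Y)
  (at level 40, left associativity) : program_scope.

(* Main.v *)
(** A composition is, up to isomorphism, the disjoint sum of the two event
    types with an explicit order, so each law of partial strings is witnessed
    by the evident bijection between iterated sums.  Both compositions are
    monotone for refinement, hence the laws lift to downward closed sets; the
    exchange law holds because the identity on the four summands sends
    [(u;x)∥(v;y)] into the stronger order of [(u∥v);(x∥y)].  Least fixed
    points come from Knaster-Tarski. *)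
Require Import Defs.
From mathcomp Require Import all_boot.
From mathcomp Require Import boolp classical_sets functions cardinality.

Local Open Scope classical_set_scope.
Local Open Scope program_scope.

(** * Least fixed points of monotone maps *)

Section KnasterTarski.
Variables (Q : Type) (le : Relation_Definitions.relation Q) (sup : set Q -> Q).

(** The witness is the meet [m] of all [x] with [le (f x) x]. Monotonicity puts [f m] below each
    such [x], so [f m] lies below [m]; then [f m] belongs to the same set, so [m] lies below
    [f m]. *)
Lemma knaster_tarski (f : Q -> Q) :
  is_complete_lattice le sup ->
  (forall x y, le x y -> le (f x) (f y)) ->
  exists m, is_least_fixpoint le f m.
Proof.
move=> [[refl trans anti] _ glb] fmono.
have [m [mlow mgreat]] := glb [set x | le (f x) x].
have fm : le (f m) m.
  by apply: mgreat => x fx; exact: (trans _ _ _ (fmono _ _ (mlow x fx)) fx).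
exists m; split=> [|x fx]; last by apply: mlow; rewrite /= fx; exact: (refl x).
by apply: (anti _ _ fm); apply: mlow; exact: fmono.
Qed.

End KnasterTarski.

(** * Laws of partial strings up to refinement *)

Section PartialStringLaws.
Context {Gamma : Type} {E : eventUniverse}.
Implicit Types (c : connective) (u v w x y z : pstring Gamma E).

(** Morphisms run against refinement, from the weaker order to the stronger. Monotonicity is asked
    of [f] only: [g] may lose order, as happens in the exchange law. *)
Lemma refines_bij x y (f : events y -> events x) (g : events x -> events y) :
  cancel f g -> cancel g f ->
  (forall e e', prec e e' -> prec (f e) (f e')) ->
  (forall e, label e = label (f e)) -> refines x y.
Proof. by move=> fK gK fm fl; exists f; split=> //; exists g. Qed.

Section Tagging.
Context {T : Type} {f : T -> E}.

Definition to_range (t : T) : range f :=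
  exist _ (f t) (mem_set (ex_intro2 _ _ t I erefl)).

Lemma to_rangeK : injective f -> cancel to_range (@range_preim E T f).
Proof. by move=> f_inj t; apply: f_inj; rewrite range_preimK. Qed.

Lemma range_preim_to_range : cancel (@range_preim E T f) to_range.
Proof. by move=> s; apply: val_inj; rewrite /= range_preimK. Qed.

End Tagging.

(** * Events of a composition as a disjoint sum *)

Section CompositionEvents.
Context {c : connective} {x y : pstring Gamma E}.

(** Both branches coincide; the match is there because [events (pstring_comp c x y)] reduces to the
    range of [sum_event] only once [c] is a constructor. *)
Definition tag : events x + events y -> events (pstring_comp c x y) :=
  match c with Par => to_range | Seq => to_range end.

Definition untag : events (pstring_comp c x y) -> events x + events y :=
  match c with
  | Par => @range_preim E _ (@sum_event Gamma E x y)
  | Seq => @range_preim E _ (@sum_event Gamma E x y)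
  end.

Lemma tagK : cancel tag untag.
Proof.
by rewrite /tag /untag; case: c; apply: to_rangeK; exact: sum_event_inj.
Qed.

Lemma untagK : cancel untag tag.
Proof. by rewrite /tag /untag; case: c; exact: range_preim_to_range. Qed.

Lemma label_tag s : label (tag s) = match s with inl e => label e | inr e => label e end.
Proof.
transitivity (sum_label s); last by case: s.
(* Both sides now depend on [s] through [tag s] alone; once it is generalized and [c] is split, they
   are convertible by the definition of [transport]. *)
rewrite -[in RHS](tagK s).
by move: (tag s) => e; rewrite /untag; case: c e.
Qed.

(** The two compositions differ only in the entry [c = Seq], so later proofs can treat both at once.
    An equality of propositions, unlike an equivalence, serves directly as a rewrite rule. *)
Lemma prec_tag s s' : prec (tag s) (tag s') =
  match s, s' with
  | inl e, inl e' => prec e e'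
  | inr e, inr e' => prec e e'
  | inl _, inr _ => c = Seq
  | inr _, inl _ => False
  end.
Proof.
transitivity (match c with Par => par_prec s s' | Seq => seq_prec s s' end).
  rewrite -[in RHS](tagK s) -[in RHS](tagK s').
  by move: (tag s) (tag s') => e e'; rewrite /untag; case: c e e'.
by case: c s s' => -[e|e] [e'|e'] //=; apply/propext; split=> //;
  do ?[by case | by right | by left].
Qed.

Lemma tagP e : exists s, e = tag s.
Proof. by exists (untag e); rewrite untagK. Qed.

End CompositionEvents.

Lemma comp_finite c x y : finite_pstring x -> finite_pstring y ->
  finite_pstring (pstring_comp c x y).
Proof.
move=> fx fy; have evE : events (pstring_comp c x y) = range (@sum_event Gamma E x y).
  by case: c.
(* The range of [sum_event] is covered by the images of the two finite event sets under the two
   taggings. *)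
rewrite /finite_pstring /= evE; apply: (@sub_finite_set _ _
  ((fun e => tag_event (e, false)) @` events x `|`
   (fun e => tag_event (e, true)) @` events y)).
  move=> _ [[e|e] _ <-]; [left|right]; exists (val e) => //;
  exact: set_mem (valP e).
by rewrite finite_setU; split; exact: finite_image.
Qed.

(** The two morphisms act summandwise. Order between different summands depends only on [c], so it
    is preserved. *)
Lemma refines_comp c x y x' y' : refines x x' -> refines y y' ->
  refines (pstring_comp c x y) (pstring_comp c x' y').
Proof.
move=> [f [[f' fK f'K] fm fl]] [g [[g' gK g'K] gm gl]].
pose F (e : events (pstring_comp c x' y')) : events (pstring_comp c x y) :=
  tag (match untag e with inl a => inl (f a) | inr b => inr (g b) end).
pose G (e : events (pstring_comp c x y)) : events (pstring_comp c x' y') :=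
  tag (match untag e with inl a => inl (f' a) | inr b => inr (g' b) end).
apply: (@refines_bij _ _ F G) => e; have [[a|a] ->] := tagP e;
  rewrite /F /G ?tagK ?fK ?f'K ?gK ?g'K ?label_tag //=.
- by move=> e'; have [[b|b] ->] := tagP e'; rewrite ?tagK !prec_tag //; exact: fm.
- by move=> e'; have [[b|b] ->] := tagP e'; rewrite ?tagK !prec_tag //; exact: gm.
Qed.

Definition compA_fwd {c x y z} (e : events (pstring_comp c x (pstring_comp c y z))) :
    events (pstring_comp c (pstring_comp c x y) z) :=
  tag (match untag e with
       | inl a => inl (tag (inl a))
       | inr e1 => match untag e1 with
                   | inl a => inl (tag (inr a))
                   | inr a => inr a
                   end
       end).

Definition compA_bwd {c x y z} (e : events (pstring_comp c (pstring_comp c x y) z)) :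
    events (pstring_comp c x (pstring_comp c y z)) :=
  tag (match untag e with
       | inl e1 => match untag e1 with
                   | inl a => inl a
                   | inr a => inr (tag (inl a))
                   end
       | inr a => inr (tag (inr a))
       end).

Lemma compA_bwdK c x y z :
  cancel (@compA_bwd c x y z) (@compA_fwd c x y z).
Proof.
move=> e; rewrite /compA_bwd /compA_fwd.
have [[e1|a] ->] := tagP e; last by rewrite !tagK.
by have [[a|a] ->] := tagP e1; rewrite !tagK.
Qed.

Lemma compA_fwdK c x y z :
  cancel (@compA_fwd c x y z) (@compA_bwd c x y z).
Proof.
move=> e; rewrite /compA_bwd /compA_fwd.
have [[a|e1] ->] := tagP e; first by rewrite !tagK.
by have [[a|a] ->] := tagP e1; rewrite !tagK.
Qed.

(** Reassociation keeps the left-to-right sequence of the three summands, and on either side an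
    event of an earlier summand precedes one of a later summand exactly when [c = Seq]. *)
Lemma refines_compA c x y z :
  refines (pstring_comp c (pstring_comp c x y) z)
          (pstring_comp c x (pstring_comp c y z)).
Proof.
apply: refines_bij (@compA_fwdK c x y z) (@compA_bwdK c x y z) _ _.
- move=> e e'; rewrite /compA_fwd.
  have [[a|e1] ->] := tagP e; have [[a'|e1'] ->] := tagP e';
  try have [[b|b] ->] := tagP e1; try have [[b'|b'] ->] := tagP e1';
  by rewrite !(tagK, prec_tag).
- move=> e; rewrite /compA_fwd.
  have [[a|e1] ->] := tagP e; try have [[b|b] ->] := tagP e1;
  by rewrite !(tagK, label_tag).
Qed.

Lemma refines_compA_sym c x y z :
  refines (pstring_comp c x (pstring_comp c y z))
          (pstring_comp c (pstring_comp c x y) z).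
Proof.
apply: refines_bij (@compA_bwdK c x y z) (@compA_fwdK c x y z) _ _.
- move=> e e'; rewrite /compA_bwd.
  have [[e1|a] ->] := tagP e; have [[e1'|a'] ->] := tagP e';
  try have [[b|b] ->] := tagP e1; try have [[b'|b'] ->] := tagP e1';
  by rewrite !(tagK, prec_tag).
- move=> e; rewrite /compA_bwd.
  have [[e1|a] ->] := tagP e; try have [[b|b] ->] := tagP e1;
  by rewrite !(tagK, label_tag).
Qed.

Lemma refines_parC x y :
  refines (pstring_comp Par x y) (pstring_comp Par y x).
Proof.
(* Keeping the two strings as parameters makes the inverse of [F] another instance of [F]. *)
pose F x' y' (e : events (pstring_comp Par x' y')) :
    events (pstring_comp Par y' x') :=
  tag (match untag e with inl a => inr a | inr a => inl a end).
have FK x' y' : cancel (F x' y') (F y' x').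
  by move=> e; rewrite /F; have [[a|a] ->] := tagP e; rewrite !tagK.
apply: refines_bij (FK y x) (FK x y) _ _ => e; rewrite /F.
- move=> e'; have [[a|a] ->] := tagP e; have [[b|b] ->] := tagP e';
  by rewrite !tagK !prec_tag.
- by have [[a|a] ->] := tagP e; rewrite !(tagK, label_tag).
Qed.

(** On the parallel side the only order between summands is [u] before [x] and [v] before [y]. The
    sequential side has both, and also [u] before [y] and [v] before [x], so the refinement goes one
    way. *)
Lemma refines_exchange u v x y :
  refines (pstring_comp Seq (pstring_comp Par u v) (pstring_comp Par x y))
          (pstring_comp Par (pstring_comp Seq u x) (pstring_comp Seq v y)).
Proof.
(* This swaps the two middle summands. With both connectives as parameters, the inverse is the
   instance with [c] and [c'] exchanged. *)
pose F c c' u' v' x' y'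
    (e : events (pstring_comp c (pstring_comp c' u' v') (pstring_comp c' x' y'))) :
    events (pstring_comp c' (pstring_comp c u' x') (pstring_comp c v' y')) :=
  tag (match untag e with
       | inl e1 => match untag e1 with
                   | inl a => inl (tag (inl a))
                   | inr a => inr (tag (inl a))
                   end
       | inr e1 => match untag e1 with
                   | inl a => inl (tag (inr a))
                   | inr a => inr (tag (inr a))
                   end
       end).
have FK c c' u' v' x' y' : cancel (F c c' u' v' x' y') (F c' c u' x' v' y').
  by move=> e; rewrite /F; have [[e1|e1] ->] := tagP e;
    have [[a|a] ->] := tagP e1; rewrite !tagK.
apply: refines_bij (FK Par Seq u x v y) (FK Seq Par u v x y) _ _ => e; rewrite /F.
- move=> e'; have [[e1|e1] ->] := tagP e; have [[a|a] ->] := tagP e1;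
  have [[e1'|e1'] ->] := tagP e'; have [[a'|a'] ->] := tagP e1';
  by rewrite !(tagK, prec_tag).
- have [[e1|e1] ->] := tagP e; have [[a|a] ->] := tagP e1;
  by rewrite !(tagK, label_tag).
Qed.

Lemma bot_event_false : events (@bot_pstring Gamma E) -> False.
Proof. by move=> e; case: (set_mem (valP e)) => -[]. Qed.

(** With one summand empty, the tagging of the other is an order isomorphism. The impossible
    branches of [r] and [l] are filled from [bot_event_false]. *)
Lemma comp_bot_equiv c x : let b := bot_pstring Gamma E in
  [/\ refines x (pstring_comp c x b), refines (pstring_comp c x b) x,
      refines x (pstring_comp c b x) & refines (pstring_comp c b x) x].
Proof.
move=> b.
pose r (e : events (pstring_comp c x b)) : events x :=
  match untag e with inl a => a | inr a => False_rect _ (bot_event_false a) end.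
pose l (e : events (pstring_comp c b x)) : events x :=
  match untag e with inl a => False_rect _ (bot_event_false a) | inr a => a end.
have rK : cancel r (fun a => tag (inl a)).
  by move=> e; have [[a|a] ->] := tagP e; [rewrite /r tagK|case: (bot_event_false a)].
have rK' : cancel (fun a => tag (inl a)) r by move=> a; rewrite /r tagK.
have lK : cancel l (fun a => tag (inr a)).
  by move=> e; have [[a|a] ->] := tagP e; [case: (bot_event_false a)|rewrite /l tagK].
have lK' : cancel (fun a => tag (inr a)) l by move=> a; rewrite /l tagK.
split.
- apply: (refines_bij _ _ _ _ rK rK') => e.
    (* Writing each event as [tag (inl (r e))] exposes the form that [prec_tag] expects. *)
    by move=> e'; rewrite -{1}(rK e) -{1}(rK e') prec_tag.
  by rewrite -{1}(rK e) label_tag.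
- by apply: (refines_bij _ _ _ _ rK' rK) => e *; rewrite ?prec_tag ?label_tag.
- apply: (refines_bij _ _ _ _ lK lK') => e.
    by move=> e'; rewrite -{1}(lK e) -{1}(lK e') prec_tag.
  by rewrite -{1}(lK e) label_tag.
- by apply: (refines_bij _ _ _ _ lK' lK) => e *; rewrite ?prec_tag ?label_tag.
Qed.

End PartialStringLaws.

(** * Lifting the laws to downward closed sets *)

Section ProgramLaws.
Context {Gamma : Type} {E : eventUniverse}.
Implicit Types (c : connective) (X Y Z : program Gamma E).

Lemma program_ext X Y : program_set X = program_set Y -> X = Y.
Proof.
case: X Y => [A fA dA] [B fB dB] /= AB; subst B.
by congr Program; exact: Prop_irrelevance.
Qed.

Lemma program_anti X Y : X ⊆ Y -> Y ⊆ X -> X = Y.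
Proof. by move=> XY YX; apply: program_ext; rewrite eqEsubset. Qed.

Lemma program_complete_lattice :
  is_complete_lattice (@program_sub Gamma E) (@program_bigcup Gamma E).
Proof.
split.
- split; [by move=> X x | by move=> X Y Z XY YZ x /XY /YZ |].
  by move=> X Y; exact: program_anti.
- move=> S; split=> [X SX x Xx|Y ub x [X SX Xx]]; first by exists X.
  exact: ub Xx.
(* The meet is the union of all lower bounds, which is already known to be a program; for empty [S]
   it is the union of all programs. *)
- move=> S; exists (program_bigcup [set L | forall X, S X -> L ⊆ X]).
  split=> [X SX x [L LS Lx]|L LS x Lx]; first exact: LS Lx.
  by exists L.
Qed.

Lemma program_refines X x y : finite_pstring x -> refines x y ->
  program_set X y -> program_set X x.
Proof. by move=> fx xy Xy; rewrite -program_down; split=> //; exists y. Qed.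

(** Unfolds [down] and the image once, so that each law below reduces to choosing witnesses and
    chaining refinements. *)
Lemma program_compP c X Y w : program_set (X ⋈[c] Y) w <->
  exists x y, [/\ program_set X x, program_set Y y, finite_pstring w & refines w (pstring_comp c x y)].
Proof.
split=> [[fw [_ [[x Xx [y Yy <-]] wxy]]]|[x [y [Xx Yy fw wxy]]]].
  by exists x, y.
by split=> //; exists (pstring_comp c x y); split=> //; exists x => //; exists y.
Qed.

Lemma program_comp_mono c X X' Y Y' :
  X ⊆ X' -> Y ⊆ Y' -> X ⋈[c] Y ⊆ X' ⋈[c] Y'.
Proof.
move=> XX' YY' w /program_compP [x [y [/XX' Xx /YY' Yy fw wxy]]].
by apply/program_compP; exists x, y.
Qed.

Lemma program_compA c X Y Z : X ⋈[c] (Y ⋈[c] Z) = (X ⋈[c] Y) ⋈[c] Z.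
Proof.
apply: program_anti => w /program_compP.
- move=> [x [v [Xx /program_compP [y [z [Yy Zz _ vyz]]] fw wxv]]].
  (* The regrouped string [pstring_comp c x y] must itself lie in [X ⋈[c] Y], and [down] admits only
     finite strings. *)
  have fxy := comp_finite c x y (program_finite Xx) (program_finite Yy).
  apply/program_compP; exists (pstring_comp c x y), z; split=> //.
    by apply/program_compP; exists x, y; split=> //; exact: refines_refl.
  apply: (refines_trans wxv).
  apply: refines_trans (refines_compA_sym c x y z).
  by apply: refines_comp => //; exact: refines_refl.
- move=> [v [z [/program_compP [x [y [Xx Yy _ vxy]]] Zz fw wvz]]].
  have fyz := comp_finite c y z (program_finite Yy) (program_finite Zz).
  apply/program_compP; exists x, (pstring_comp c y z); split=> //.
    by apply/program_compP; exists y, z; split=> //; exact: refines_refl.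
  apply: (refines_trans wvz).
  apply: refines_trans (refines_compA c x y z).
  by apply: refines_comp => //; exact: refines_refl.
Qed.

(** Composing with the empty string gives [x] only up to refinement in both directions; downward
    closure of [X] turns this into an equality of programs. *)
Lemma program_comp1 c X : X ⋈[c] 1 = X.
Proof.
apply: program_anti => [w /program_compP [x [_ [Xx -> fw wx]]]|x Xx].
  have [_ h _ _] := comp_bot_equiv c x.
  exact: program_refines fw (refines_trans wx h) Xx.
apply/program_compP; exists x, (bot_pstring Gamma E); split=> //.
  exact: program_finite Xx.
by have [] := comp_bot_equiv c x.
Qed.

Lemma program_1comp c X : 1 ⋈[c] X = X.
Proof.
apply: program_anti => [w /program_compP [_ [x [-> Xx fw wx]]]|x Xx].
  have [_ _ _ h] := comp_bot_equiv c x.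
  exact: program_refines fw (refines_trans wx h) Xx.
apply/program_compP; exists (bot_pstring Gamma E), x; split=> //.
  exact: program_finite Xx.
by have [] := comp_bot_equiv c x.
Qed.

(** Membership in a composition is existential in each factor, and existentials commute with
    unions. *)
Lemma program_comp_bigcupr c X (S : set (program Gamma E)) :
  X ⋈[c] program_bigcup S = program_bigcup [set X ⋈[c] Y | Y in S].
Proof.
apply: program_anti => w.
  move=> /program_compP [x [y [Xx [Y SY Yy] fw wxy]]].
  by exists (X ⋈[c] Y); [exists Y|apply/program_compP; exists x, y].
move=> [_ [Y SY <-]] /program_compP [x [y [Xx Yy fw wxy]]].
by apply/program_compP; exists x, y; split=> //; exists Y.
Qed.

Lemma program_comp_bigcupl c X (S : set (program Gamma E)) :
  program_bigcup S ⋈[c] X = program_bigcup [set Y ⋈[c] X | Y in S].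
Proof.
apply: program_anti => w.
  move=> /program_compP [y [x [[Y SY Yy] Xx fw wxy]]].
  by exists (Y ⋈[c] X); [exists Y|apply/program_compP; exists y, x].
move=> [_ [Y SY <-]] /program_compP [y [x [Yy Xx fw wxy]]].
by apply/program_compP; exists y, x; split=> //; exists Y.
Qed.

(** Makes binary distributivity an instance of the infinitary law; [program_bigcup0] does the same
    for annihilation by [0]. *)
Lemma program_cupE X Y : X ∪ Y = program_bigcup [set X; Y].
Proof.
apply: program_anti => [x [Xx|Yx]|x [_ [->|->] ?]];
  by [exists X => //; left | exists Y => //; right | left | right].
Qed.

Lemma program_comp_cupr c X Y Z : X ⋈[c] (Y ∪ Z) = (X ⋈[c] Y) ∪ (X ⋈[c] Z).
Proof. by rewrite !program_cupE program_comp_bigcupr image_setU !image_set1. Qed.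

Lemma program_comp_cupl c X Y Z : (X ∪ Y) ⋈[c] Z = (X ⋈[c] Z) ∪ (Y ⋈[c] Z).
Proof. by rewrite !program_cupE program_comp_bigcupl image_setU !image_set1. Qed.

Lemma program_bigcup0 : program_bigcup set0 = 0 :> program Gamma E.
Proof. by apply: program_anti => x // []. Qed.

Lemma program_comp0 c X : X ⋈[c] 0 = 0.
Proof. by rewrite -program_bigcup0 program_comp_bigcupr image_set0. Qed.

Lemma program_0comp c X : 0 ⋈[c] X = 0.
Proof. by rewrite -program_bigcup0 program_comp_bigcupl image_set0. Qed.

Lemma program_parC X Y : X ∥ Y = Y ∥ X.
Proof.
by apply: program_anti => w /program_compP [x [y [Xx Yy fw wxy]]];
  apply/program_compP; exists y, x; split=> //;
  exact: refines_trans wxy (refines_parC x y).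
Qed.

Lemma program_exchange (U V X Y : program Gamma E) :
  (U ∥ V) ⨟ (X ∥ Y) ⊆ (U ⨟ X) ∥ (V ⨟ Y).
Proof.
move=> w /program_compP [a [b [/program_compP [u [v [Uu Vv _ auv]]]
  /program_compP [x [y [Xx Yy _ bxy]]] fw wab]]].
apply/program_compP; exists (pstring_comp Seq u x), (pstring_comp Seq v y).
split=> //.
- apply/program_compP; exists u, x; split=> //; last exact: refines_refl.
  exact: (comp_finite Seq u x (program_finite Uu) (program_finite Xx)).
- apply/program_compP; exists v, y; split=> //; last exact: refines_refl.
  exact: (comp_finite Seq v y (program_finite Vv) (program_finite Yy)).
apply: refines_trans (refines_exchange u v x y).
(* [a] and [b] are first replaced by the parallel compositions that they refine, to which the
   exchange law for strings applies. *)
by apply: (refines_trans wab); exact: (refines_comp Seq).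
Qed.

Lemma program_comp_quantale c :
  is_unital_quantale (@program_sub Gamma E) (@program_bigcup Gamma E)
    (@program_comp c Gamma E) 1.
Proof.
split; first exact: program_complete_lattice.
- by split=> [X Y Z|X|X];
    [exact: program_compA|exact: program_1comp|exact: program_comp1].
- exact: program_comp_bigcupr.
- by move=> X S; exact: program_comp_bigcupl.
Qed.

Lemma program_sub_cup X Y : X ⊆ Y <-> X ∪ Y = Y.
Proof.
split=> [XY|<- x Xx]; last by left.
by apply: program_anti => x; [case=> // /XY|right].
Qed.

Lemma program_star c (P : program Gamma E) :
  exists M, is_least_fixpoint (@program_sub Gamma E)
    (fun X => 1 ∪ (P ⋈[c] X)) M.
Proof.
(* What remains is monotonicity of the map: the summand [1] is constant and the other is monotone by
   [program_comp_mono]. *)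
apply: knaster_tarski program_complete_lattice _ => X Y XY x [?|Xx].
  by left.
by right; apply: program_comp_mono Xx.
Qed.

End ProgramLaws.

Theorem mainTheorem1 (Gamma : Type) (E : eventUniverse) :
  is_complete_lattice (@program_sub Gamma E) (@program_bigcup Gamma E) /\
  (forall X Y : program Gamma E,
     is_lub (@program_sub Gamma E) [set X; Y] (X ∪ Y)) /\
  (forall X : program Gamma E, 0 ⊆ X) /\
  (forall c : connective,
     is_unital_quantale (@program_sub Gamma E) (@program_bigcup Gamma E)
       (@program_comp c Gamma E) 1) /\
  (forall X Y : program Gamma E, X ⊆ Y <-> X ∪ Y = Y) /\
  (forall U V X Y : program Gamma E,
     (U ∥ V) ⨟ (X ∥ Y) ⊆ (U ⨟ X) ∥ (V ⨟ Y)) /\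
  (forall X Y Z : program Gamma E, X ∪ (Y ∪ Z) = (X ∪ Y) ∪ Z) /\
  (forall X : program Gamma E, X ∪ X = X) /\
  (forall X : program Gamma E, X ∪ 0 = X /\ 0 ∪ X = X) /\
  (forall X Y : program Gamma E, X ∪ Y = Y ∪ X) /\
  (forall X Y : program Gamma E, X ∥ Y = Y ∥ X) /\
  (forall X : program Gamma E, X ∥ 1 = X /\ 1 ∥ X = X) /\
  (forall X : program Gamma E, X ⨟ 1 = X /\ 1 ⨟ X = X) /\
  (forall X : program Gamma E, X ∥ 0 = 0 /\ 0 ∥ X = 0) /\
  (forall X : program Gamma E, X ⨟ 0 = 0 /\ 0 ⨟ X = 0) /\
  (forall (c : connective) (X Y Z : program Gamma E),
     X ⋈[c] (Y ∪ Z) = (X ⋈[c] Y) ∪ (X ⋈[c] Z)) /\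
  (forall (c : connective) (X Y Z : program Gamma E),
     (X ∪ Y) ⋈[c] Z = (X ⋈[c] Z) ∪ (Y ⋈[c] Z)) /\
  (forall (c : connective) (X Y Z : program Gamma E),
     X ⋈[c] (Y ⋈[c] Z) = (X ⋈[c] Y) ⋈[c] Z) /\
  (forall (c : connective) (P : program Gamma E),
     exists M : program Gamma E,
       is_least_fixpoint (@program_sub Gamma E)
         (fun X : program Gamma E => 1 ∪ (P ⋈[c] X)) M).
Proof.
split; first exact: program_complete_lattice.
split=> [X Y|].
  rewrite program_cupE; have [_ lub _] := @program_complete_lattice Gamma E.
  exact: lub.
split=> [X x []|].
split; first exact: program_comp_quantale.
split; first exact: program_sub_cup.
split; first exact: program_exchange.
split=> [X Y Z|]; first by apply: program_ext; exact: setUA.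
split=> [X|]; first by apply: program_ext; exact: setUid.
split=> [X|].
  by split; apply: program_ext; [exact: setU0|exact: set0U].
split=> [X Y|]; first by apply: program_ext; exact: setUC.
split; first exact: program_parC.
split=> [X|]; first by rewrite program_comp1 program_1comp.
split=> [X|]; first by rewrite program_comp1 program_1comp.
split=> [X|]; first by rewrite program_comp0 program_0comp.
split=> [X|]; first by rewrite program_comp0 program_0comp.
split; first exact: program_comp_cupr.
split; first exact: program_comp_cupl.
split; first exact: program_compA.
exact: program_star.
Qed.
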